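(* Let $\mathscr{H}$ be the family of all subgroups of $\mathbb{T}^{\mathbb{N}}$ that are controllable in $\mathbb{T}^{\mathbb{N}}$ but not uniformly controllable in $\mathbb{T}^{\mathbb{N}}$. Then $|\mathscr{H}|=2^{\mathfrak{c}}$.
   Context: $\mathbb{T}$ is the circle group, $\mathfrak{c}$ is the cardinality of the continuum, and $\mathbb{T}^{\mathbb{N}}$ is the direct product of countably many copies of $\mathbb{T}$. For a family of groups $\{G_i:i\in I\}$ with direct product $G=\prod_{i\in I}G_i$ and $K\subseteq I$, $\bigoplus_{i\in K}G_i$ denotes the subgroup of $G$ consisting of all $g\in G$ such that $g(i)$ is the identity of $G_i$ for all but finitely many $i\in I$ and for every $i\in I\setminus K$. For $J\subseteq I$, $p_{IJ}:\prod_{i\in I}G_i\to\prod_{j\in J}G_j$ is the projection $g\mapsto g\restriction_J$. A subgroup $H$ of $G$ is: controllable in $G$ if $p_{IJ}(H)=p_{IJ}(H\cap\bigoplus_{i\in I}G_i)$ for every finite set $J\subseteq I$; uniformly controllable in $G$ if for every finite set $J\subseteq I$ there exists a finite set $K\subseteq I$ such that $p_{IJ}(H)=p_{IJ}(H\cap\bigoplus_{i\in K}G_i)$. *)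

(* Defs.v *)
From HB Require Import structures.
From mathcomp Require Export all_boot all_order all_algebra.
From mathcomp Require Export complex.
From mathcomp Require Export boolp classical_sets functions cardinality reals.

Set Implicit Arguments.
Unset Strict Implicit.
Unset Printing Implicit Defensive.

Import Order.TTheory GRing.Theory Num.Theory.

Local Open Scope classical_set_scope.
Local Open Scope group_scope.

Section Circle.
Variable R : realType.
Local Open Scope ring_scope.

Definition circle := {z : R[i] | `|z| == 1}.

HB.instance Definition _ := Choice.on circle.

Fact circle1_subproof : `|1 : R[i]| == 1.
Proof. by rewrite normr1. Qed.

Fact circleM_subproof (x y : circle) : `|val x * val y| == 1.
Proof. by rewrite normrM (eqP (valP x)) (eqP (valP y)) mulr1. Qed.

Fact circleV_subproof (x : circle) : `|(val x)^-1| == 1.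
Proof. by rewrite normfV (eqP (valP x)) invr1. Qed.

Definition circle_one : circle := exist _ 1 circle1_subproof.
Definition circle_mul (x y : circle) : circle :=
  exist _ (val x * val y) (circleM_subproof x y).
Definition circle_inv (x : circle) : circle :=
  exist _ (val x)^-1 (circleV_subproof x).

Fact circle_mulA : associative circle_mul.
Proof. by move=> x y z; apply: val_inj; rewrite /= mulrA. Qed.

Fact circle_mul1 : left_id circle_one circle_mul.
Proof. by move=> x; apply: val_inj; rewrite /= mul1r. Qed.

Fact circle_mulr1 : right_id circle_one circle_mul.
Proof. by move=> x; apply: val_inj; rewrite /= mulr1. Qed.

Fact circle_unit (x : circle) : val x != 0.
Proof. by rewrite -normr_eq0 (eqP (valP x)) oner_eq0. Qed.

Fact circle_mulV : left_inverse circle_one circle_inv circle_mul.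
Proof. by move=> x; apply: val_inj; rewrite /= mulVf ?circle_unit. Qed.

Fact circle_mulrV : right_inverse circle_one circle_inv circle_mul.
Proof. by move=> x; apply: val_inj; rewrite /= mulfV ?circle_unit. Qed.

HB.instance Definition _ := isGroup.Build circle
  circle_mulA circle_mul1 circle_mulr1 circle_mulV circle_mulrV.

End Circle.

Section DirectProduct.
Variables (I : Type) (G : I -> groupType).

Definition direct_product := forall i, G i.

HB.instance Definition _ := Choice.on direct_product.

Definition direct_product_one : direct_product := fun i => 1.
Definition direct_product_mul (g h : direct_product) : direct_product :=
  fun i => g i * h i.
Definition direct_product_inv (g : direct_product) : direct_product :=
  fun i => (g i)^-1.

Fact direct_product_mulA : associative direct_product_mul.
Proof.
by move=> f g h; apply: functional_extensionality_dep => i; exact: mulgA.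
Qed.

Fact direct_product_mul1 : left_id direct_product_one direct_product_mul.
Proof. by move=> g; apply: functional_extensionality_dep => i; exact: mul1g. Qed.

Fact direct_product_mulr1 : right_id direct_product_one direct_product_mul.
Proof. by move=> g; apply: functional_extensionality_dep => i; exact: mulg1. Qed.

Fact direct_product_mulV :
  left_inverse direct_product_one direct_product_inv direct_product_mul.
Proof. by move=> g; apply: functional_extensionality_dep => i; exact: mulVg. Qed.

Fact direct_product_mulrV :
  right_inverse direct_product_one direct_product_inv direct_product_mul.
Proof. by move=> g; apply: functional_extensionality_dep => i; exact: mulgV. Qed.

HB.instance Definition _ := isGroup.Build direct_product
  direct_product_mulA direct_product_mul1 direct_product_mulr1
  direct_product_mulV direct_product_mulrV.

End DirectProduct.

Definition subgroup (gT : groupType) (H : set gT) : Prop :=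
  group_closed [in H].

Section Controllability.
Variables (I : Type) (G : I -> groupType).

Definition direct_sum (K : set I) : set (direct_product G) :=
  [set g | finite_set [set i | g i != 1] /\ forall i, ~ K i -> g i = 1].

Definition proj_on (J : set I) (g : direct_product G) :
    direct_product (fun j : J => G (val j)) :=
  fun j => g (val j).
Arguments proj_on J g : clear implicits.

Definition controllable (H : set (direct_product G)) : Prop :=
  forall J : set I, finite_set J ->
    proj_on J @` H = proj_on J @` (H `&` direct_sum setT).

Definition uniformly_controllable (H : set (direct_product G)) : Prop :=
  forall J : set I, finite_set J -> exists2 K : set I, finite_set K &
    proj_on J @` H = proj_on J @` (H `&` direct_sum K).

End Controllability.
Arguments proj_on {I G} J g : rename.

Definition circle_power_nat (R : realType) : groupType :=
  direct_product (fun _ : nat => circle R).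

(* Main.v *)
Require Import Defs.
From mathcomp Require Import lra.

(** Upper bound: the circle power has only continuum many elements, hence at
    most 2^c subsets.  A sequence of unit complex numbers is coded by a set of
    naturals ([encode_sequence_inj]), and sets of naturals are coded by reals
    through ternary expansions ([ternary_inj]); taking direct images under the
    composite sends distinct sets of sequences to distinct sets of reals.

    Lower bound: let I be a proper ideal of subsets of nat that contains all
    finite sets, and let H(I) ([chain_subgroup]) consist of the sequences g
    whose support lies in I and for which g(n) and g(n+1) have the same power
    of exponent 2^(n+1), for every n.

    - H(I) is controllable: no member of I is cofinite, so every g in H(I)
      takes the value 1 at arbitrarily large M, and cutting g off at such an M
      breaks none of the chain conditions.
    - H(I) is not uniformly controllable: if g in H(I) is trivial at N, then
      following the chain from 0 to N gives g(0)^(2^N) = 1, whereas a root of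
      unity of order 2^(N+1), repeated at the places 0, ..., N, is a finitely
      supported member of H(I).
    - I is recovered from H(I): every sequence of signs satisfies the chain
      conditions, since all the exponents are even, so X belongs to I exactly
      when the sequence equal to -1 on X and 1 elsewhere belongs to H(I).

    It remains to find 2^c ideals.  The codes of the pairs (n, floor(n x)) form
    an infinite set of naturals A(x) for each real x, and A(x), A(y) have finite
    intersection when x and y differ.  For a set S of reals take the ideal
    generated by the finite sets and the A(x) with x in S: it contains A(y) only
    when y is in S, because no A(y) is covered, up to finitely many points, by
    finitely many other A(x).  The same fact shows that the ideal is proper. *)

Set Implicit Arguments.
Unset Strict Implicit.
Unset Printing Implicit Defensive.

Import Order.TTheory GRing.Theory Num.Theory.

Local Open Scope classical_set_scope.
Local Open Scope card_scope.

(** * Injections and finite sets *)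

Lemma card_le_injective (T U : Type) (f : T -> U) (A : set T) (B : set U) :
  injective f -> A `<=` f @^-1` B -> A #<= B.
Proof.
move=> f_inj AB; have /card_esym : f @` A #= A.
  by apply: inj_card_eq => x y _ _; exact: f_inj.
rewrite card_eq_le => /andP[/card_le_trans + _]; apply.
by apply: subset_card_le => _ [x Ax <-]; exact: AB.
Qed.

Lemma image_set_inj (T U : Type) (f : T -> U) :
  injective f -> injective (fun A : set T => f @` A).
Proof.
move=> f_inj A B AB; apply/seteqP; split=> x.
  by rewrite -(image_inj f_inj) AB image_inj.
by rewrite -(image_inj f_inj) -AB image_inj.
Qed.

Lemma finite_set_nat_lt (J : set nat) :
  finite_set J -> exists N, forall j, J j -> (j < N)%N.
Proof.
move=> /finite_seqP[s ->]; exists (\max_(i <- s) i).+1 => j /= js.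
by rewrite ltnS; exact: leq_bigmax_seq.
Qed.

(** * Sets of naturals are coded by reals *)

Section TernaryEncoding.
Variable R : realType.
Local Open Scope ring_scope.
Implicit Types (A B : set nat) (m n : nat).

Definition ternary_sum A n : R := \sum_(i < n) (nat_of_ord i \in A)%:R * 3 ^- i.

Definition ternary A : R := sup (range (ternary_sum A)).

Lemma ternary_sumS A n :
  ternary_sum A n.+1 = ternary_sum A n + (n \in A)%:R * 3 ^- n.
Proof. by rewrite /ternary_sum big_ord_recr. Qed.

Lemma ternary_pow_gt0 n : 0 < 3 ^- n :> R.
Proof. by rewrite invr_gt0 exprn_gt0. Qed.

Lemma ternary_powS n : 3 ^- n.+1 = 3 ^- n / 3 :> R.
Proof. by rewrite exprSr invfM mulrC. Qed.

Lemma ternary_sum_mono A m n : (m <= n)%N -> ternary_sum A m <= ternary_sum A n.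
Proof.
move=> /subnK <-; elim: (n - m)%N => [//|k /le_trans]; apply.
by rewrite addSn ternary_sumS lerDl mulr_ge0// ltW// ternary_pow_gt0.
Qed.

(** The geometric tail: what all the digits from place n on can still
    contribute is at most the sum of the 3^-i for i >= n, which is 3/2 * 3^-n.
    So the partial sums increase, while the partial sums augmented by this
    bound decrease. *)
Lemma ternary_sum_tail A m n : (m <= n)%N ->
  ternary_sum A n + 3 / 2 * 3 ^- n <= ternary_sum A m + 3 / 2 * 3 ^- m.
Proof.
move=> /subnK <-; elim: (n - m)%N => [//|k]; apply: le_trans.
rewrite addSn ternary_sumS ternary_powS.
have := ternary_pow_gt0 (k + m); case: (_ \in A) => /= h; lra.
Qed.

Lemma ternary_sum_le A m n :
  ternary_sum A n <= ternary_sum A m + 3 / 2 * 3 ^- m.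
Proof.
have [mn|/ltnW nm] := leqP m n.
  apply: le_trans (ternary_sum_tail A mn).
  by rewrite lerDl; have := ternary_pow_gt0 n; lra.
apply: le_trans (ternary_sum_mono A nm) _.
by rewrite lerDl; have := ternary_pow_gt0 m; lra.
Qed.

Lemma ternary_ge A n : ternary_sum A n <= ternary A.
Proof.
apply: ub_le_sup; last by exists n.
exists (ternary_sum A 0 + 3 / 2 * 3 ^- 0) => _ [m _ <-].
exact: ternary_sum_le.
Qed.

Lemma ternary_le A n : ternary A <= ternary_sum A n + 3 / 2 * 3 ^- n.
Proof.
apply: ge_sup; first by exists (ternary_sum A 0), 0%N.
by move=> _ [m _ <-]; exact: ternary_sum_le.
Qed.

(** At the first place n where A and B differ, the digit of A contributes 3^-n,
    and everything after place n contributes at most half of that to B. *)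
Lemma ternary_lt A B n : (forall i, (i < n)%N -> (i \in A) = (i \in B)) ->
  n \in A -> n \notin B -> ternary B < ternary A.
Proof.
move=> AB nA nB.
have eqn : ternary_sum A n = ternary_sum B n.
  by apply: eq_bigr => i _; rewrite AB.
have := ternary_ge A n.+1; have := ternary_le B n.+1.
rewrite !ternary_sumS nA (negbTE nB) ternary_powS eqn /=.
have := ternary_pow_gt0 n; lra.
Qed.

Lemma ternary_inj : injective ternary.
Proof.
move=> A B eqAB; apply: contrapT => neqAB.
have exd : exists i, (i \in A) != (i \in B).
  apply: contrapT => /forallNP alleq; apply: neqAB; apply/seteqP; split=> i iA.
    by apply/set_mem; rewrite -(eqP (negPn (introN idP (alleq i)))) mem_set.
  by apply/set_mem; rewrite (eqP (negPn (introN idP (alleq i)))) mem_set.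
have [n neqn minn] := ex_minnP exd.
have agree i : (i < n)%N -> (i \in A) = (i \in B).
  move=> i_lt; apply/eqP; apply: contraLR i_lt => /minn.
  by rewrite leqNgt.
have := neqn; have [nA|nA] := boolP (n \in A).
  rewrite eq_sym eqb_id => nB; have := ternary_lt agree nA nB.
  by rewrite eqAB ltxx.
rewrite eq_sym eqbF_neg negbK => nB.
have := ternary_lt (fun i i_lt => esym (agree i i_lt)) nB nA.
by rewrite eqAB ltxx.
Qed.

End TernaryEncoding.

(** * An almost disjoint family indexed by the reals *)

Section AlmostDisjoint.
Variable R : realType.
Local Open Scope ring_scope.

Definition approximation (x : R) (n : nat) : nat :=
  pickle (n, Num.floor (n%:R * x)).

Definition approximations (x : R) : set nat := range (approximation x).

Lemma approximations_infinite (x : R) : infinite_set (approximations x).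
Proof.
apply/infiniteP; apply: (@card_le_injective _ _ (approximation x)).
  by move=> m n /(pcan_inj pickleK)[].
by move=> n _; exists n.
Qed.

(** If floor(n x) = floor(n y), then n |x - y| <= 1, which leaves only finitely
    many n; and a common code forces the same n on both sides. *)
Lemma approximations_almost_disjoint (x y : R) : x != y ->
  finite_set (approximations x `&` approximations y).
Proof.
move=> neqxy; pose N := Num.truncn (`|x - y|^-1).
have d_gt0 : 0 < `|x - y| by rewrite normr_gt0 subr_eq0.
apply: (@sub_finite_set _ _ (approximation x @` `I_N.+1)); last first.
  exact/finite_image/finite_II.
move=> _ [[n _ <-] [m _]] /(pcan_inj pickleK)[-> eq_floor]; exists n => //=.
rewrite ltnS leqNgt; apply/negP => N_lt.
have: `|x - y|^-1 < n%:R.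
  apply: lt_le_trans (truncnS_gt _) _.
  by rewrite ler_nat.
rewrite invf_plt ?posrE//; last first.
  by rewrite ltr0n (leq_ltn_trans _ N_lt).
have n_gt0 : 0 < n%:R :> R by rewrite ltr0n (leq_ltn_trans _ N_lt).
rewrite -div1r ltr_pdivrMr//; apply/negP; rewrite -leNgt.
rewrite -[X in _ * X]gtr0_norm// -normrM mulrBl.
have := floor_itv (n%:R * x); have := floor_itv (n%:R * y).
rewrite eq_floor !(mulrC n%:R) intrD.
move=> /andP[y1 y2] /andP[x1 x2]; rewrite ler_norml; apply/andP; split; lra.
Qed.

(** An infinite set is not almost disjoint from itself. *)
Lemma approximations_inj : injective approximations.
Proof.
move=> x y eqxy; apply/eqP; apply: contrapT => /negP.
move=> /approximations_almost_disjoint.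
by rewrite eqxy setIid => /(@approximations_infinite y).
Qed.


(** Almost disjointness makes the trace of a finite union of other members of
    the family on A(y) finite, so an infinite part of A(y) is left. *)
Lemma approximations_not_covered (F : set R) (y : R) : finite_set F -> ~ F y ->
  infinite_set (approximations y `\` \bigcup_(x in F) approximations x).
Proof.
move=> finF nFy; set U := \bigcup_(x in F) _.
have finyU : finite_set (approximations y `&` U).
  rewrite setI_bigcupr; apply: bigcup_finite => // x Fx.
  by apply: approximations_almost_disjoint; apply: contra_not_neq nFy => ->.
apply: (sub_infinite_set _ (infinite_setD (@approximations_infinite y) finyU)).
by move=> k [yk nyUk]; split=> // Uk; exact: nyUk.
Qed.

(** The ideal generated by the finite sets and the members of the almost
    disjoint family with index in S. *)
Definition approximation_ideal (S : set R) : set (set nat) :=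
  [set X | exists F : set R, [/\ finite_set F, F `<=` S &
     finite_set (X `\` \bigcup_(x in F) approximations x)]].

End AlmostDisjoint.

(** * Proper ideals of sets of naturals *)

Definition proper_ideal (I : set (set nat)) : Prop :=
  [/\ forall X, finite_set X -> I X,
      forall X Y, X `<=` Y -> I Y -> I X,
      forall X Y, I X -> I Y -> I (X `|` Y) &
      ~ I setT].

(** A member containing every M >= N would, together with the finite set of the
    naturals below N, put the whole of nat in the ideal. *)
Lemma proper_ideal_unbounded (I : set (set nat)) (X : set nat) (N : nat) :
  proper_ideal I -> I X -> exists2 M, (N <= M)%N & ~ X M.
Proof.
move=> [fin sub union nIT] IX; apply: contrapT => nM; apply: nIT.
apply: sub (union _ _ IX (fin _ (finite_II N))) => k _.
have [Nk|kN] := leqP N k; last by right.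
by left; apply: contrapT => nXk; apply: nM; exists k.
Qed.

Section ApproximationIdeal.
Variable R : realType.

Lemma infinite_setT_real : infinite_set [set: R].
Proof.
apply/infiniteP; apply: (@card_le_injective _ _ (fun n : nat => n%:R%R)) => //.
by move=> m n /eqP; rewrite eqr_nat => /eqP.
Qed.

Lemma approximation_idealE (S : set R) (x : R) :
  approximation_ideal S (approximations x) <-> S x.
Proof.
split=> [[F [finF FS]]|Sx].
  by apply: contraPP => nSx; apply: approximations_not_covered => // /FS.
exists [set x]; split; [exact: finite_set1|by move=> _ ->|].
by rewrite bigcup_set1 setDv.
Qed.

Lemma approximation_ideal_inj : injective (@approximation_ideal R).
Proof.
by move=> S T eqST; apply/seteqP; split=> x /approximation_idealE;
  rewrite (eqST, =^~ eqST) => /approximation_idealE.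
Qed.

Lemma approximation_ideal_proper (S : set R) :
  proper_ideal (approximation_ideal S).
Proof.
split.
- move=> X finX; exists set0; split=> //; rewrite bigcup_set0 setD0//.
- move=> X Y XY [F [finF FS finY]]; exists F; split=> //.
  by apply: sub_finite_set finY; exact: setSD.
- move=> X Y [F [finF FS finX]] [G [finG GS finY]]; exists (F `|` G); split.
  + by rewrite finite_setU.
  + by rewrite subUset.
  rewrite bigcup_setU setDUl finite_setU; split.
    by apply: sub_finite_set finX => k [Xk nFG]; split=> // Fk; apply: nFG; left.
  by apply: sub_finite_set finY => k [Yk nFG]; split=> // Gk; apply: nFG; right.
move=> [F [finF _]].
have [y [_ nFy]] := infinite_setN0 (infinite_setD infinite_setT_real finF).
apply/sub_infinite_set/(approximations_not_covered finF nFy).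
exact: setSD.
Qed.

End ApproximationIdeal.

(** * Subgroups attached to ideals *)

Section ChainSubgroup.
Variable R : realType.
Local Notation C := (circle R).
Local Notation G := (circle_power_nat R).
Local Open Scope group_scope.

Lemma circle_mulC (x y : C) : commute x y.
Proof. by apply: val_inj; exact: mulrC. Qed.

Lemma circle_val_exp (x : C) n : val (x ^+ n) = (val x ^+ n)%R.
Proof. by elim: n => [//|n IHn]; rewrite expgS exprS -IHn. Qed.

Definition circle_opp1 : C := exist _ (-1)%R (introT eqP (@normrN1 R[i])).

Lemma circle_opp1_neq1 : circle_opp1 != 1.
Proof. by rewrite -val_eqE /= eq_sym -addr_eq0 -mulr2n pnatr_eq0. Qed.

Lemma circle_opp1_sqr : circle_opp1 ^+ 2 = 1.
Proof. by apply: val_inj; rewrite circle_val_exp /= sqrrN expr1n. Qed.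

Lemma circle_sqrt (x : C) : exists y : C, y ^+ 2 = x.
Proof.
have norm1 : (`|sqrtc (val x)| == 1)%R.
  by rewrite -(@pexpr_eq1 _ _ 2)// -normrX sqr_sqrtc (valP x).
by exists (exist _ (sqrtc (val x)) norm1); apply: val_inj;
  rewrite circle_val_exp /= sqr_sqrtc.
Qed.

(** The element z is a 2^n-th root of -1, obtained by iterated square roots. *)
Lemma circle_dyadic_order n :
  exists z : C, z ^+ (2 ^ n) != 1 /\ z ^+ (2 ^ n.+1) = 1.
Proof.
suff [z zE] : exists z : C, z ^+ (2 ^ n) = circle_opp1.
  exists z; rewrite zE circle_opp1_neq1; split=> //.
  by rewrite expnSr expgnA zE circle_opp1_sqr.
elim: n => [|n [z zE]]; first by exists circle_opp1; rewrite expg1.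
by have [y yE] := circle_sqrt z; exists y; rewrite expnS expgnA yE.
Qed.

Definition support (g : G) : set nat := [set n | g n != 1].

(** The exponent 2^(n+1) grows with n so that the chain from 0 to N controls
    only the 2^N-th power of the first term; it is even from n = 0 on so that
    sequences of signs are never excluded. *)
Definition chain_subgroup (I : set (set nat)) : set G :=
  [set g | I (support g) /\
    forall n, g n ^+ (2 ^ n.+1) = g n.+1 ^+ (2 ^ n.+1)].

Definition sign_sequence (X : set nat) : G :=
  fun n => if n \in X then circle_opp1 else 1.

Lemma sign_sequence_support X : support (sign_sequence X) = X.
Proof.
apply/seteqP; split=> n; rewrite /support /sign_sequence /=.
  by case: ifPn => [/set_mem//|_]; rewrite eqxx.
by move=> /mem_set ->; exact: circle_opp1_neq1.
Qed.

Lemma sign_sequence_chain I X : chain_subgroup I (sign_sequence X) <-> I X.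
Proof.
rewrite /chain_subgroup /= sign_sequence_support.
split=> [[]//|IX]; split=> // n.
have sign1 k : sign_sequence X k ^+ (2 ^ n.+1) = 1.
  rewrite /sign_sequence expnS expgnA.
  by case: ifP => _; rewrite ?circle_opp1_sqr ?expg1n.
by rewrite !sign1.
Qed.

Lemma chain_subgroup_inj : injective chain_subgroup.
Proof.
by move=> I J eqIJ; apply/seteqP; split=> X /sign_sequence_chain;
  rewrite (eqIJ, =^~ eqIJ) => /sign_sequence_chain.
Qed.

Section Properties.
Variable I : set (set nat).
Hypothesis I_proper : proper_ideal I.

Lemma chain_subgroup_subgroup : subgroup (chain_subgroup I).
Proof.
have [fin sub union _] := I_proper.
split=> [|g h]; rewrite !inE.
  split=> [|n]; last by rewrite !expg1n.
  by apply: fin; apply: sub_finite_set (finite_set0 _) => n /=;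
    rewrite /support /= eqxx.
move=> [Ig chain_g] [Ih chain_h]; split=> [|n].
  apply: sub (union _ _ Ig Ih) => n; rewrite /support /= => ghn.
  apply: contrapT => /not_orP[/negP/negPn/eqP g1 /negP/negPn/eqP h1].
  move: ghn; rewrite [X in X != _](_ : _ = g n * (h n)^-1)//.
  by rewrite g1 h1 mulgV eqxx.
have divX k m : (g / h) k ^+ m = g k ^+ m / h k ^+ m.
  by rewrite -expgnFl//; exact: circle_mulC.
by rewrite !divX chain_g chain_h.
Qed.

(** A member g agrees on J with its truncation at some M beyond J where g is 1:
    the only new chain condition, at M - 1, compares with that same value 1. *)
Lemma chain_subgroup_controllable : controllable (chain_subgroup I).
Proof.
have [fin _ _ _] := I_proper.
move=> J finJ; apply/seteqP; split=> _ [g Hg <-]; last first.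
  by exists g => //; case: Hg.
have [N JN] := finite_set_nat_lt finJ.
have [M NM /negP/negPn/eqP gM] := proper_ideal_unbounded N I_proper (proj1 Hg).
pose h : G := fun n => if (n < M)%N then g n else 1.
have h_fin : finite_set (support h).
  apply: sub_finite_set (finite_II M) => n; rewrite /support /h /=.
  by case: ifP => //; rewrite eqxx.
exists h.
  split; last by split=> // n /(_ Logic.I).
  split=> [|n]; first exact: fin.
  (* M <= n.+1 splits into M <= n, where both terms are 1, and M = n.+1 *)
  rewrite /h; have [nM|nM|nM] := ltngtP n.+1 M.
  - exact: (proj2 Hg).
  - by [].
  - by rewrite (proj2 Hg) nM gM.
apply: functional_extensionality_dep => j; rewrite /proj_on /h.
by rewrite (leq_trans (JN _ (set_mem (valP j))) NM).
Qed.

(** Already for J = {0} no finite K works: with K below N, the members supported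
    in K start with a 2^N-th root of unity, but a constant run of length N + 1 of
    an element of order 2^(N+1) does not. *)
Lemma chain_subgroup_not_uniform : ~ uniformly_controllable (chain_subgroup I).
Proof.
have [fin _ _ _] := I_proper.
move=> /(_ [set 0%N] (finite_set1 _))[K finK].
have [N KN] := finite_set_nat_lt finK.
have [z [z_neq1 z_eq1]] := circle_dyadic_order N.
pose g : G := fun n => if (n <= N)%N then z else 1.
have Hg : chain_subgroup I g.
  split=> [|n].
    apply: fin; apply: sub_finite_set (finite_II N.+1) => n.
    by rewrite /support /g /= ltnS; case: ifP => //; rewrite eqxx.
  rewrite /g; case: (ltngtP n N) => // ->.
  by rewrite z_eq1 expg1n.
move=> /seteqP[/(_ (proj_on [set 0%N] g)) sub _].
have [|h [[_ chain_h] [_ hK]] eqhg] := sub; first by exists g.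
have h0 : h 0%N = z.
  have zero_in : 0%N \in [set 0%N] by rewrite inE.
  exact: (congr1 (fun f => f (SigSub zero_in)) eqhg).
have hN : h N = 1 by apply: hK => /KN; rewrite ltnn.
have down k : (k <= N)%N -> h 0%N ^+ (2 ^ N) = h k ^+ (2 ^ N).
  elim: k => [//|k IHk] kN; rewrite (IHk (ltnW kN)).
  (* 2 ^ k.+1 divides 2 ^ N, so the condition at k may be raised to the 2 ^ N *)
  by rewrite -(subnKC kN) expnD !expgnA chain_h.
by move: z_neq1; rewrite -h0 (down N)// hN expg1n eqxx.
Qed.

End Properties.
End ChainSubgroup.

(** * The circle power has at most continuum many elements *)

Section Encoding.
Variable R : realType.

(** Each real is replaced by its set of approximations, so that countably many
    reals, here the real (b = true) and imaginary parts of all the terms, can be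
    merged into one set of naturals. *)
Definition encode_sequence (g : circle_power_nat R) : set nat :=
  [set k | exists n b j, k = pickle (n : nat, b : bool, j : nat) /\
     approximations
       (if b then complex.Re (val (g n)) else complex.Im (val (g n))) j].

Lemma encode_sequence_inj : injective encode_sequence.
Proof.
move=> g h eqgh; apply: functional_extensionality_dep => n; apply: val_inj.
have part b : (if b then complex.Re (val (g n)) else complex.Im (val (g n))) =
              (if b then complex.Re (val (h n)) else complex.Im (val (h n))).
  apply: approximations_inj; apply/seteqP; split=> j gj.
    have : encode_sequence g (pickle (n, b, j)) by exists n, b, j.
    by rewrite eqgh => -[_ [_ [_ [/(pcan_inj pickleK)[<- <- <-]]]]].
  have : encode_sequence h (pickle (n, b, j)) by exists n, b, j.
  by rewrite -eqgh => -[_ [_ [_ [/(pcan_inj pickleK)[<- <- <-]]]]].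
have := part true; have := part false.
by case: (val (g n)) (val (h n)) => [a b] [c d] /= -> ->.
Qed.

End Encoding.

(* [set: set R] is the power set of the continuum, of cardinality 2 ^ c *)
Theorem corollary3p4 (R : realType) :
  [set H : set (circle_power_nat R) |
    [/\ subgroup H, controllable H & ~ uniformly_controllable H]]
  #= [set: set R].
Proof.
rewrite card_eq_le; apply/andP; split.
  apply: card_le_injective => //.
  apply: image_set_inj; exact: inj_comp (@ternary_inj R) (@encode_sequence_inj R).
apply: (@card_le_injective _ _
  (fun S => @chain_subgroup R (approximation_ideal S))).
  exact: inj_comp (@chain_subgroup_inj R) (@approximation_ideal_inj R).
move=> S _; have I_proper := approximation_ideal_proper S; split.
- exact: chain_subgroup_subgroup.
- exact: chain_subgroup_controllable.
- exact: chain_subgroup_not_uniform.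
Qed.
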